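(* For $n\ge2$ and $d\ge2$, let $H_{n,d}$ be the number of hoe permutations in $S^d_n$ (defined in the context). Then \[H_{n,d}=\sum_{k=0}^{n-2}\left(2^{d-1}-1\right)^k.\]
   Context: For $n\ge1$, $S_n$ is the set of permutations of $\{0,\dots,n-1\}$ in one-line notation. For $d\ge2$, $S^d_n$ is the set of $(d-1)$-tuples $\Pi=(\pi^2,\dots,\pi^d)$ of elements of $S_n$; its elements are the columns $\Pi_j=(\pi^2_j,\dots,\pi^d_j)^T$, and the level of $\Pi_j$ is $\mathrm{lev}(\Pi_j)=\max\{\pi^2_j,\dots,\pi^d_j\}$. An ascent (resp. descent) of $\Pi$ is an index $j$ with $\mathrm{lev}(\Pi_j)<\mathrm{lev}(\Pi_{j+1})$ (resp. $>$). $\Pi$ is unimodal if its level vector consists of (possibly zero) ascents followed by (possibly zero) descents, i.e. $\mathrm{lev}(\Pi_1)<\dots<\mathrm{lev}(\Pi_m)>\mathrm{lev}(\Pi_{m+1})>\dots>\mathrm{lev}(\Pi_n)$ for some $m$. $\Pi$ is a hoe permutation if it is unimodal and has exactly one descent, located at position $n-1$, i.e. $\mathrm{lev}(\Pi_1)<\mathrm{lev}(\Pi_2)<\dots<\mathrm{lev}(\Pi_{n-1})>\mathrm{lev}(\Pi_n)$. *)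

(* Defs.v *)
From mathcomp Require Import all_boot all_fingroup.

Set Implicit Arguments.
Unset Strict Implicit.
Unset Printing Implicit Defensive.

(* The tuple (pi^2, ..., pi^d) is reindexed from 0, and so are the positions:
   the mathematical column j, 1 <= j <= n, is the one of index j - 1 in 'I_n. *)
Notation dperm d n := (d.-1.-tuple 'S_n).

Section DPerm.
Variables d n : nat.
Implicit Types (Pi : dperm d n) (j : 'I_n).

Definition column Pi j : d.-1.-tuple 'I_n :=
  [tuple tnth Pi i j | i < d.-1].

(* \max over the empty range is 0, but d.-1 > 0 whenever d >= 2. *)
Definition lev Pi j : nat := \max_(x <- column Pi j) (x : nat).

Definition ascents Pi : {set 'I_n} :=
  [set j : 'I_n | [exists k : 'I_n, (k == j.+1 :> nat) && (lev Pi j < lev Pi k)]].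

Definition descents Pi : {set 'I_n} :=
  [set j : 'I_n | [exists k : 'I_n, (k == j.+1 :> nat) && (lev Pi j > lev Pi k)]].

Definition unimodal Pi : bool :=
  [exists m : 'I_n, forall j : 'I_n, (j.+1 < n) ==>
     (if j < m then j \in ascents Pi else j \in descents Pi)].

(* The position n - 1, counted from 1, is the j with j + 2 = n from 0. *)
Definition hoe Pi : bool :=
  [&& unimodal Pi, #|descents Pi| == 1 & [forall j in descents Pi, j.+2 == n]].

End DPerm.

Definition num_hoe (n d : nat) : nat := #|[set Pi : dperm d n | hoe Pi]|.

(* Main.v *)
Require Import Defs.
From mathcomp Require Import all_boot all_fingroup.

(** Call a tuple in [S^d_n] rising if its levels increase strictly except
    possibly at the last step.  In a rising tuple of size [m + 2] every
    permutation takes its maximal value in one of the last two columns.  Deleting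
    these maxima merges the last two columns into one.  If all maxima lie in the
    last column, the levels increase throughout and all permutations are the
    identity; for each of the [2 ^ (d - 1) - 1] other distributions of the maxima,
    what remains is an arbitrary rising tuple of size [m + 1].  So the number
    [G m] of rising tuples satisfies
    [G (m + 2) = 1 + (2 ^ (d - 1) - 1) * G (m + 1)].  A hoe permutation is a rising
    tuple with all maxima in the last but one column, hence [H (m + 2) = G (m + 1)]. *)

Set Implicit Arguments.
Unset Strict Implicit.
Unset Printing Implicit Defensive.

(** * Levels, ascents and descents *)

Section Levels.
Variables d n : nat.
Implicit Types (Pi : dperm d n.+1) (j : 'I_n.+1).

Lemma levE Pi j : lev Pi j = \max_(i < d.-1) (tnth Pi i j : nat).
Proof. by rewrite /lev big_tuple; apply: eq_bigr => i _; rewrite tnth_mktuple. Qed.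

Lemma leq_tnth_lev Pi i j : tnth Pi i j <= lev Pi j.
Proof. by rewrite levE (leq_bigmax (F := fun i => tnth Pi i j : nat)). Qed.

Lemma lev_max Pi j : lev Pi j <= n.
Proof. by rewrite levE; apply/bigmax_leqP => i _; rewrite -ltnS. Qed.

Lemma mem_ascents Pi k : k < n ->
  (inord k \in ascents Pi) = (lev Pi (inord k) < lev Pi (inord k.+1)).
Proof.
move=> ltkn; rewrite inE inordK ?(ltnW ltkn) //; last exact: ltnW.
apply/existsP/idP => [[j /andP[/eqP jE]]|lt_lev].
  by rewrite -jE inord_val.
by exists (inord k.+1); rewrite inordK ?eqxx.
Qed.

Lemma mem_descents Pi k : k < n ->
  (inord k \in descents Pi) = (lev Pi (inord k) > lev Pi (inord k.+1)).
Proof.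
move=> ltkn; rewrite inE inordK; last exact: ltnW.
apply/existsP/idP => [[j /andP[/eqP jE]]|lt_lev].
  by rewrite -jE inord_val.
by exists (inord k.+1); rewrite inordK ?eqxx.
Qed.

Lemma descents_ltn Pi j : j \in descents Pi -> j < n.
Proof. by rewrite inE => /existsP[k /andP[/eqP kE _]]; rewrite -ltnS -kE. Qed.

(** By strong induction on [j]: if [s j < j], then [s j] is already known to be a fixed point, and
    injectivity forces [s j = j]. *)
Lemma perm_le_id (s : 'S_n.+1) : (forall j, s j <= j) -> s = 1%g.
Proof.
move=> le_s; apply/permP => j; rewrite perm1.
have [k] := ubnP (j : nat); elim: k j => // k IHk j lt_jk.
apply/eqP; rewrite -val_eqE eqn_leq le_s /= leqNgt; apply/negP => lt_sj.
have /perm_inj sj : s (s j) = s j by apply: IHk; exact: leq_trans lt_sj _.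
by rewrite sj ltnn in lt_sj.
Qed.

Lemma lev_id j : 1 < d -> lev ([tuple 1%g | i < d.-1] : dperm d n.+1) j = j.
Proof.
move=> d_gt1; have ord_d : 'I_d.-1 by exists 0; rewrite -ltnS prednK // ltnW.
rewrite levE; apply/eqP; rewrite eqn_leq; apply/andP; split.
  by apply/bigmax_leqP => i _; rewrite tnth_mktuple perm1.
apply: leq_trans (leq_bigmax ord_d).
by rewrite tnth_mktuple perm1.
Qed.

Lemma increasing_lev_id Pi :
    (forall k, k < n -> lev Pi (inord k) < lev Pi (inord k.+1)) ->
  Pi = [tuple 1%g | i < d.-1].
Proof.
(* Going down from the last column, whose level is at most [n], each step loses at least one; so
   every permutation lies pointwise below the identity. *)
move=> incr; have le_lev k : k <= n -> lev Pi (inord (n - k)) <= n - k.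
  elim: k => [|k IHk] lt_kn; first by rewrite subn0 lev_max.
  rewrite -ltnS subnSK //; apply: leq_trans (IHk (ltnW lt_kn)).
  have := incr (n - k.+1); rewrite subnSK //; apply.
  exact: leq_subr.
apply: eq_from_tnth => i; rewrite tnth_mktuple; apply: perm_le_id => j.
apply: leq_trans (leq_tnth_lev _ _ _) _.
have le_jn : j <= n by rewrite -ltnS.
by have := le_lev _ (leq_subr j n); rewrite subKn // inord_val.
Qed.

End Levels.

(** * Rising tuples and hoe permutations *)

Definition rising d n : {set dperm d n} :=
  [set Pi | [forall j : 'I_n, (j.+2 < n) ==> (j \in ascents Pi)]].

Lemma risingP d n (Pi : dperm d n.+1) :
  reflect (forall k, k.+1 < n -> lev Pi (inord k) < lev Pi (inord k.+1))
          (Pi \in rising d n.+1).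
Proof.
rewrite inE; apply: (iffP forallP) => [asc k lt_kn|asc j].
  rewrite -mem_ascents ?(ltnW lt_kn) //; apply: (implyP (asc _)).
  by rewrite inordK // ltnW // ltnW.
apply/implyP => lt_jn; rewrite -[j]inord_val mem_ascents; first exact: asc.
exact: ltnW.
Qed.

Lemma hoeE d m (Pi : dperm d m.+2) :
  hoe Pi = (Pi \in rising d m.+2) && (lev Pi (inord m.+1) < lev Pi (inord m)).
Proof.
have mE : (inord m : 'I_m.+2) = m :> nat by rewrite inordK.
apply/idP/andP => [/and3P[/existsP[t /forallP uni]]|[/risingP asc desc]].
  move=> /cards1P[x dE]; rewrite dE => /forall_inP end_desc.
  split; last first.
    rewrite -mem_descents // dE inE.
    have := end_desc x; rewrite inE eqxx => /(_ isT) /eqP[xE].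
    by rewrite -[x]inord_val xE.
  apply/risingP => k lt_km; rewrite -mem_ascents ?(ltnW lt_km) //.
  have kE : (inord k : 'I_m.+2) = k :> nat by rewrite inordK // ltnW // ltnW.
  have := implyP (uni (inord k)); rewrite kE ltnW // => /(_ isT).
  (* From the peak [t] on, [k] would be a descent, but the only descent is at [m]. *)
  case: ifP => // _; rewrite dE => /end_desc; rewrite kE !eqSS => /eqP kE'.
  by rewrite kE' ltnn in lt_km.
have dE : descents Pi = [set inord m].
  apply/setP => x; rewrite [RHS]inE; apply/idP/eqP => [xd|->]; last first.
    by rewrite mem_descents.
  have lt_xm := descents_ltn xd.
  apply: val_inj; rewrite /= mE; apply/eqP; rewrite eqn_leq -ltnS lt_xm leqNgt.
  apply/negP => lt_x; move: xd; rewrite -[x]inord_val mem_descents //.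
  by rewrite ltnNge ltnW // asc.
apply/and3P; split.
- apply/existsP; exists (inord m); apply/forallP => j; apply/implyP => lt_j.
  rewrite mE dE; case: ltnP => [lt_jm|le_mj].
    by rewrite -[j]inord_val mem_ascents ?asc.
  rewrite inE; apply/eqP/val_inj; rewrite /= mE.
  by apply/eqP; rewrite eqn_leq le_mj -ltnS -ltnS lt_j.
- by rewrite dE cards1.
- by rewrite dE; apply/forall_inP => j; rewrite inE => /eqP->; rewrite mE.
Qed.

(** * Deleting and inserting the maxima *)

Lemma lift_perm_inj n i j : injective (@lift_perm n i j).
Proof.
move=> s t eq_st; apply/permP => k; apply: (@lift_inj _ j).
by rewrite -!(lift_perm_lift i) eq_st.
Qed.

Lemma lift_permP n (i j : 'I_n.+1) (s : 'S_n.+1) :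
  s i = j -> exists t, s = lift_perm i j t.
Proof.
(* The default [k] is never taken: [s] reaches [j] only at [i], and [lift i k] avoids [i]. *)
move=> sij; pose f k := odflt k (unlift j (s (lift i k))).
have fE k : lift j (f k) = s (lift i k).
  rewrite /f; case: unliftP => [k' ->|] //= /eqP.
  by rewrite -sij (inj_eq perm_inj) eq_sym (negPf (neq_lift _ _)).
have f_inj : injective f.
  by move=> k l /(congr1 (lift j)); rewrite !fE => /perm_inj /lift_inj.
exists (perm f_inj); apply/permP => k.
case: (unliftP i k) => [l|] ->; last by rewrite lift_perm_id.
by rewrite lift_perm_lift permE fE.
Qed.

Section Insertion.
Variables d m : nat.
Implicit Types (A : d.-1.-tuple bool) (Pi : dperm d m.+1).

Let pos (b : bool) : 'I_m.+2 := inord (m + b).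

(* [tnth A i] tells whether the new maximum of the [i]-th permutation goes to the
   last column, rather than to the last but one. *)
Definition insert_max A Pi : dperm d m.+2 :=
  [tuple lift_perm (pos (tnth A i)) ord_max (tnth Pi i) | i < d.-1].

Let val_pos b : pos b = m + b :> nat.
Proof. by rewrite inordK //; case: b; rewrite ?addn1 ?addn0. Qed.

Let pos_inj : injective pos.
Proof. by move=> b c /(congr1 val) /=; rewrite !val_pos => /addnI; case: b c => [] []. Qed.

Lemma insert_max_pos A Pi i : tnth (insert_max A Pi) i (pos (tnth A i)) = ord_max.
Proof. by rewrite tnth_mktuple lift_perm_id. Qed.

Lemma insert_max_lift A Pi i k :
  tnth (insert_max A Pi) i (lift (pos (tnth A i)) k) = tnth Pi i k :> nat.
Proof. by rewrite tnth_mktuple lift_perm_lift lift_max. Qed.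

Lemma insert_max_inj A B Pi Sigma :
  insert_max A Pi = insert_max B Sigma -> A = B /\ Pi = Sigma.
Proof.
move=> eqI; have eqA : A = B.
  apply: eq_from_tnth => i; apply/pos_inj/(@perm_inj _ (tnth (insert_max A Pi) i)).
  by rewrite insert_max_pos eqI insert_max_pos.
split=> //; apply: eq_from_tnth => i.
by move/(congr1 (fun P => tnth P i)): eqI; rewrite !tnth_mktuple eqA => /lift_perm_inj.
Qed.

Lemma lev_insert_low A Pi k : k < m ->
  lev (insert_max A Pi) (inord k) = lev Pi (inord k).
Proof.
move=> lt_km; rewrite !levE; apply: eq_bigr => i _.
rewrite -(insert_max_lift A); congr (nat_of_ord (tnth (insert_max _ _) i _)).
apply: val_inj; rewrite /= val_pos !inordK ?(leq_trans lt_km) //; last exact: leqW.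
by rewrite /bump leqNgt (leq_trans lt_km) ?leq_addr.
Qed.

Lemma lev_insert_max A Pi b : b \in A -> lev (insert_max A Pi) (inord (m + b)) = m.+1.
Proof.
case/tnthP => i ->; apply/eqP; rewrite eqn_leq lev_max.
by have := leq_tnth_lev (insert_max A Pi) i (pos (tnth A i)); rewrite insert_max_pos.
Qed.

(** When all maxima share one of the last two columns, the other one inherits the old last column
    unchanged. *)
Lemma lev_insert_rest Pi b :
  lev (insert_max [tuple b | i < d.-1] Pi) (inord (m + ~~ b)) = lev Pi (inord m).
Proof.
rewrite !levE; apply: eq_bigr => i _.
rewrite -(insert_max_lift [tuple b | i < d.-1]).
congr (nat_of_ord (tnth (insert_max _ _) i _)); rewrite tnth_mktuple; apply: val_inj.
by rewrite /= !val_pos inordK //; case: b; rewrite /bump ?addn1 ?addn0 ?ltnn ?leqnn.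
Qed.

(** If all maxima go last, the first [m + 1] columns keep the levels of [Pi], which must then
    increase throughout. Otherwise column [m] has the top level [m + 1], so the step into it is
    automatic and only the steps among the first [m] columns constrain [Pi]. *)
Lemma rising_insert A Pi : 1 < d ->
  (insert_max A Pi \in rising d m.+2) =
    if A == [tuple true | i < d.-1] then Pi == [tuple 1%g | i < d.-1]
    else Pi \in rising d m.+1.
Proof.
move=> d_gt1; case: eqP => [->|/eqP A_mixed].
  have lev_lt Sigma k : k < m.+1 ->
      lev (insert_max [tuple true | i < d.-1] Sigma) (inord k) = lev Sigma (inord k).
    rewrite ltnS leq_eqVlt => /predU1P[->|]; last exact: lev_insert_low.
    by have := lev_insert_rest Sigma true; rewrite addn0.
  apply/risingP/eqP => [incr|-> k lt_km].
    apply: increasing_lev_id => k lt_km.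
    by rewrite -!lev_lt ?incr // ltnW.
  by rewrite !lev_lt ?lev_id // ?inordK // ltnW.
have A_false : false \in A.
  apply: contraR A_mixed => A_true; apply/eqP/eq_from_tnth => i.
  rewrite tnth_mktuple; case Ai: (tnth A i) => //.
  by rewrite -Ai mem_tnth in A_true.
apply/risingP/risingP => incr k lt_km.
  by have := incr k (ltnW lt_km); rewrite !lev_insert_low // ltnW.
rewrite lev_insert_low //; move: lt_km; rewrite ltnS leq_eqVlt.
case/predU1P => [kE|lt_km]; last by rewrite lev_insert_low ?incr.
by have := lev_insert_max Pi A_false; rewrite addn0 kE => ->; rewrite ltnS lev_max.
Qed.

Lemma rising_insertP (Pi : dperm d m.+2) :
  Pi \in rising d m.+2 -> exists A Sigma, Pi = insert_max A Sigma.
Proof.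
move/risingP => incr.
have max_pos i : exists b, tnth Pi i (pos b) = ord_max.
  pose j := ((tnth Pi i)^-1)%g ord_max.
  have jE : tnth Pi i j = ord_max by rewrite permKV.
  (* A maximum in an earlier column [j] would leave no larger level for column [j + 1]. *)
  have le_mj : m <= j.
    rewrite leqNgt; apply/negP => lt_jm.
    have := incr j lt_jm; rewrite inord_val ltnNge => /negP[].
    apply: leq_trans (lev_max _ _) _.
    by have := leq_tnth_lev Pi i j; rewrite jE.
  exists (m < j); rewrite -jE; congr (tnth Pi i _); apply: val_inj.
  rewrite /= val_pos; apply/eqP; case: ltngtP le_mj => // [lt_mj|mE] _.
    by rewrite addn1 eqn_leq lt_mj -ltnS ltn_ord.
  by rewrite addn0; apply/eqP.
have [A maxA] := fin_all_exists max_pos.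
have [T permT] := fin_all_exists (fun i => lift_permP (maxA i)).
exists [tuple A i | i < d.-1], [tuple T i | i < d.-1].
by apply: eq_from_tnth => i; rewrite !tnth_mktuple permT.
Qed.

(** A maximum in the last column gives it the top level and excludes a final descent. With all
    maxima in column [m], the last column has level at most [m], so the descent is automatic. *)
Lemma hoe_insert A Pi : 1 < d ->
  hoe (insert_max A Pi) = (A == [tuple false | i < d.-1]) && (Pi \in rising d m.+1).
Proof.
move=> d_gt1; have ord_d : 'I_d.-1 by exists 0; rewrite -ltnS prednK // ltnW.
have false_neq_true : [tuple false | i < d.-1] != [tuple true | i < d.-1].
  by apply/eqP => /(congr1 (fun A => tnth A ord_d)); rewrite !tnth_mktuple.
rewrite hoeE; have [->|A_mixed] := eqVneq.
  rewrite rising_insert // (negPf false_neq_true); case: (Pi \in _) => //=.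
  have /(lev_insert_max Pi) : false \in [tuple false | i < d.-1].
    by apply/tnthP; exists ord_d; rewrite tnth_mktuple.
  have := lev_insert_rest Pi false.
  by rewrite addn0 addn1 => -> ->; rewrite ltnS lev_max.
have A_true : true \in A.
  apply: contraR A_mixed => A_false; apply/eqP/eq_from_tnth => i.
  rewrite tnth_mktuple; case Ai: (tnth A i) => //.
  by rewrite -Ai mem_tnth in A_false.
by have := lev_insert_max Pi A_true; rewrite addn1 => ->; rewrite ltnNge lev_max andbF.
Qed.

End Insertion.

(** * Counting *)

Lemma card_rising1 d : #|rising d 1| = 1.
Proof.
rewrite -[RHS](cards1 ([tuple 1%g | i < d.-1] : dperm d 1)).
congr #|pred_of_set _|; apply/setP => Pi; rewrite [RHS]inE.
(* With a single column the condition on the levels is vacuous. *)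
have -> : Pi = [tuple 1%g | i < d.-1] by apply: increasing_lev_id.
by rewrite eqxx; apply/risingP.
Qed.

Lemma card_risingS d m : 1 < d ->
  #|rising d m.+2| = 1 + (2 ^ d.-1 - 1) * #|rising d m.+1|.
Proof.
move=> d_gt1.
pose AT := [tuple true | i < d.-1]; pose PT : dperm d m.+1 := [tuple 1%g | i < d.-1].
pose ins (u : d.-1.-tuple bool * dperm d m.+1) := insert_max u.1 u.2.
have ins_inj : injective ins.
  by move=> [A Pi] [B Sigma] /insert_max_inj /= [-> ->].
(* The two cases of [rising_insert] become a disjoint union, whose parts give the two terms of the
   recursion. *)
have -> : rising d m.+2 = ins @: ((AT, PT) |: setX [set~ AT] (rising d m.+1)).
  apply/setP => Pi; apply/idP/imsetP => [rise|[[A Sigma]]].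
    have [A [Sigma PiE]] := rising_insertP rise; exists (A, Sigma) => //.
    move: rise; rewrite PiE rising_insert // in_setU1 in_setX in_setC1 xpair_eqE.
    by case: eqP => //= _ /eqP->; rewrite eqxx.
  rewrite in_setU1 in_setX in_setC1 xpair_eqE /ins /= => AS ->.
  by rewrite rising_insert //; case: eqP AS => //= _; rewrite orbF.
rewrite card_imset // cardsU1 in_setX in_setC1 eqxx cardsX cardsC1.
by rewrite card_tuple card_bool subn1.
Qed.

Lemma card_rising d m : 1 < d ->
  #|rising d m.+1| = \sum_(0 <= k < m.+1) (2 ^ d.-1 - 1) ^ k.
Proof.
move=> d_gt1; elim: m => [|m IHm]; first by rewrite card_rising1 big_nat1.
rewrite card_risingS // IHm [RHS]big_nat_recl // expn0 big_distrr /=.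
by congr (_ + _); apply: eq_bigr => k _; rewrite expnS.
Qed.

Theorem theorem3p14 (n d : nat) (hn : 2 <= n) (hd : 2 <= d) :
  num_hoe n d = \sum_(0 <= k < n.-1) (2 ^ d.-1 - 1) ^ k.
Proof.
(* For [n = m + 2] the sum counts the rising tuples of size [m + 1]; inserting all maxima in the
   last but one column maps these bijectively onto the hoe permutations. *)
case: n hn => [|[|m]] // _; rewrite /= -card_rising // /num_hoe.
have ins_inj : injective (insert_max (m := m) [tuple false | i < d.-1]).
  by move=> Pi Sigma /insert_max_inj [].
rewrite -(card_imset _ ins_inj); congr #|pred_of_set _|.
apply/setP => Pi; rewrite inE; apply/idP/imsetP => [hoePi|[Sigma rise ->]].
  have [|A [Sigma PiE]] := @rising_insertP d m Pi.
    by move: hoePi; rewrite hoeE => /andP[].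
  move: hoePi; rewrite PiE hoe_insert // => /andP[/eqP-> rise].
  by exists Sigma.
by rewrite hoe_insert // eqxx.
Qed.
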